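(* Let $0<p,q<1$ with $p\neq q$, and let $\Gamma(P(S^2_{pq\phi}))$ be the differential calculus obtained by gluing together $\Gamma(P(D_p))$ and $\Gamma(P(D_q))$. Then $\Gamma^0(P(S^2_{pq\phi}))=P(S^2_{pq\phi})$, and $$\Gamma^n(P(S^2_{pq\phi}))=\Gamma^n(P(D_p))\oplus\Gamma^n(P(D_q))\qquad\text{for all } n>0,$$ the identification being given by the map $(\pi_{1_\Gamma},\pi_{2_\Gamma})$.
   Context: For $0<q<1$, $P(D_q)$ is the unital algebra generated by $x,x^*$ with the relation $x^*x-qxx^*=(1-q)1$; $\phi_q:P(D_q)\to C(S^1)$ is the unital homomorphism $x\mapsto a$, $x^*\mapsto a^*=a^{-1}$, with $a$ the canonical unitary generator of $C(S^1)$. $P(S^2_{pq\phi})$ is identified with the fibered product $\{(f,g)\in P(D_p)\oplus P(D_q)\mid\phi_p(f)=\phi_q(g)\}$, with projections $\pi_1:P(S^2_{pq\phi})\to P(D_p)$ and $\pi_2:P(S^2_{pq\phi})\to P(D_q)$. For an algebra $A$, $\Omega(A)$ denotes the universal differential calculus over $A$. $\Gamma(P(D_q))$ is the quotient of $\Omega(P(D_q))$ by the differential ideal (two-sided graded ideal stable under $d$) generated by $x\,dx-q^{-1}(dx)x$, $x^*dx^*-q(dx^* )x^*$, $x\,dx^*-q^{-1}(dx^* )x$, $x^*dx-q(dx)x^*$; likewise $\Gamma(P(D_p))$ with $p$ in place of $q$. Let $\pi_{1_{\Omega\to\Gamma}}:\Omega(P(S^2_{pq\phi}))\to\Gamma(P(D_p))$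 and $\pi_{2_{\Omega\to\Gamma}}:\Omega(P(S^2_{pq\phi}))\to\Gamma(P(D_q))$ be given by $a_0da_1\cdots da_n\mapsto\pi_i(a_0)d\pi_i(a_1)\cdots d\pi_i(a_n)$. The glued calculus is $\Gamma(P(S^2_{pq\phi}))=\Omega(P(S^2_{pq\phi}))/(\ker\pi_{1_{\Omega\to\Gamma}}\cap\ker\pi_{2_{\Omega\to\Gamma}})$, and $\pi_{i_\Gamma}$ are the maps induced on it by $\pi_{i_{\Omega\to\Gamma}}$. *)

(* Defs.v *)
From HB Require Import structures.
From mathcomp Require Import all_boot all_order all_algebra.
From mathcomp Require Import complex.
From mathcomp Require Import boolp classical_sets functions reals topology.
From mathcomp Require Import normedtype.
From mathcomp Require Import -(notations) monalg.

Set Implicit Arguments.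
Unset Strict Implicit.
Unset Printing Implicit Defensive.

Import Order.TTheory GRing.Theory Num.Theory.
Import numFieldNormedType.Exports.

Local Open Scope classical_set_scope.
Local Open Scope quotient_scope.
Local Open Scope ring_scope.

(** The free unital algebra on a set [X], characterized by its universal
    property; [free_generated] says that it is generated by [X].  Below, free
    and quotient algebras are used through such specifications only, their
    concrete constructions being sealed to keep unification tractable. *)
Record free_algebra (K : fieldType) (X : Type) := FreeAlgebra {
  free_sort : algType K;
  free_gen : X -> free_sort;
  free_ext : forall B : algType K, (X -> B) -> {lrmorphism free_sort -> B};
  free_extE : forall (B : algType K) (h : X -> B) x, free_ext h (free_gen x) = h x;
  free_generated : forall P : free_sort -> Prop,
    (forall f g, P f -> P g -> P (f + g)) ->
    (forall k f, P f -> P (k *: f)) -> P 1 ->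
    (forall x f, P f -> P (free_gen x * f)) ->
    forall f, P f
}.

Definition malg_free (K : fieldType) (X : choiceType) : Type :=
  malg (fmonom X) K.

HB.instance Definition _ (K : fieldType) (X : choiceType) :=
  GRing.Lalgebra.on (malg_free K X).

Section FreeAlgebra.
Variables (K : fieldType) (X : choiceType).
Local Notation F := (malg_free K X).

Definition malg_gen (x : X) : F := mkmalgU (fmu x) 1.

Lemma malg_scalerAr (k : K) (f g : F) : k *: (f * g) = f * (k *: g).
Proof.
have central (h : F) : malgC k * h = h * malgC k.
  rewrite malgM_def fgmulUg malgM_def fgmulgU; apply/eq_bigr => w _.
  by rewrite mul1m mulm1 mulrC.
by rewrite -!mul_malgC mulrA central mulrA.
Qed.
HB.instance Definition _ := GRing.Lalgebra_isAlgebra.Build K F malg_scalerAr.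

Lemma malg_ind (P : F -> Prop) :
    (forall f g, P f -> P g -> P (f + g)) ->
    (forall k f, P f -> P (k *: f)) -> P 1 ->
    (forall x f, P f -> P (malg_gen x * f)) ->
  forall f, P f.
Proof.
move=> PD PZ P1 PM f; rewrite (monalgE f).
elim/big_ind: _ => [|//|w _]; first by rewrite -(scale0r 1); apply: PZ.
have -> : mkmalgU w (mcoeff w f) = mcoeff w f *: (mkmalgU w 1 : F).
  by apply/malgP => u; rewrite mcoeffZ !mcoeffU mulrnAr mulr1.
apply: PZ; case: w => s; elim: s => [|x s IHs].
  by rewrite -fmoneE.
suff -> : (mkmalgU (FMonom (x :: s)) 1 : F) = malg_gen x * mkmalgU (FMonom s) 1.
  exact: PM.
rewrite malgM_def fgmulUU mulr1; congr mkmalgU.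
by rewrite /mmul /= fmmulE fmuE.
Qed.

Section Lift.
Variables (B : algType K) (h : X -> B).

Let hw (w : fmonom X) : B := \prod_(x <- w) h x.
Let hw_mmorphism : mmorphism hw.
Proof.
by split=> [u v|]; rewrite /hw ?fm1 ?big_nil // fmM big_cat.
Qed.
HB.instance Definition _ := isMultiplicative.Build _ _ hw hw_mmorphism.

Definition malg_lift : F -> B := mmap (in_alg B) hw.

Let malg_lift_additive : zmod_morphism malg_lift.
Proof. exact: mmap_is_additive. Qed.
Let malg_lift_multiplicative : monoid_morphism malg_lift.
Proof.
have [|fM f1] := @commr_mmap_is_multiplicative _ _ _ (in_alg B) hw.
  by move=> f u v /=; rewrite /GRing.comm mulr_algl mulr_algr.
by split.
Qed.
Let malg_lift_scalable : scalable malg_lift.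
Proof. by move=> k f; rewrite /malg_lift mmapZ /= mulr_algl. Qed.
HB.instance Definition _ :=
  GRing.isZmodMorphism.Build F B malg_lift malg_lift_additive.
HB.instance Definition _ :=
  GRing.isMonoidMorphism.Build F B malg_lift malg_lift_multiplicative.
HB.instance Definition _ :=
  GRing.isScalable.Build K F B *:%R malg_lift malg_lift_scalable.

Lemma malg_lift_gen x : malg_lift (malg_gen x) = h x.
Proof.
by rewrite /malg_lift mmapU /= scale1r mul1r /hw fmuE big_seq1.
Qed.

End Lift.

Definition malg_free_algebra : free_algebra K X :=
  @FreeAlgebra K X F malg_gen (fun B h => @malg_lift B h) malg_lift_gen
    malg_ind.

End FreeAlgebra.

(** [{classic X}] equips [X] with the choice structure required by [malg]. *)
Lemma free_algebra_exists (K : fieldType) (X : Type) : free_algebra K X.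
Proof. exact: (@malg_free_algebra K {classic X}). Qed.

Section Free.
Variables (K : fieldType) (X : Type).
Definition free : algType K := free_sort (free_algebra_exists K X).
Definition gen (x : X) : free := free_gen (free_algebra_exists K X) x.
Definition free_lift (B : algType K) (h : X -> B) : {lrmorphism free -> B} :=
  free_ext (free_algebra_exists K X) h.
Lemma free_liftE (B : algType K) (h : X -> B) x : free_lift h (gen x) = h x.
Proof. exact: free_extE. Qed.
End Free.
Arguments gen K {X} x.

Section Ideals.
Variables (K : fieldType) (A : algType K).

(** Proper two-sided ideals: quotients must be nontrivial rings to carry an
    [algType] structure. *)
Record ideal := Ideal {
  ideal_set :> A -> Prop;
  ideal0 : ideal_set 0;
  idealD : forall a b, ideal_set a -> ideal_set b -> ideal_set (a + b);
  idealMl : forall a b, ideal_set b -> ideal_set (a * b);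
  idealMr : forall a b, ideal_set a -> ideal_set (a * b);
  ideal_proper : ~ ideal_set 1
}.

Inductive generated (S : set A) : A -> Prop :=
| generated_base a : S a -> generated S a
| generated0 : generated S 0
| generatedD a b : generated S a -> generated S b -> generated S (a + b)
| generatedMl a b : generated S b -> generated S (a * b)
| generatedMr a b : generated S a -> generated S (a * b).

Definition ideal_gen (S : set A) (S1 : ~ generated S 1) : ideal :=
  @Ideal (generated S) (generated0 S) (@generatedD S)
    (@generatedMl S) (@generatedMr S) S1.

Lemma idealN (I : ideal) a : I a -> I (- a).
Proof. by move=> Ia; rewrite -mulN1r; apply: idealMl. Qed.

Lemma idealZ (I : ideal) (k : K) a : I a -> I (k *: a).
Proof. by move=> Ia; rewrite -mulr_algl; apply: idealMl. Qed.

Lemma idealB (I : ideal) a b : I a -> I b -> I (a - b).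
Proof. by move=> Ia Ib; apply: idealD => //; apply: idealN. Qed.

End Ideals.

(** The quotient algebra: a surjective algebra map with kernel [I]. *)
Record quotient_algebra (K : fieldType) (A : algType K) (I : ideal A) :=
  QuotientAlgebra {
    quotient_sort : algType K;
    quotient_map : {lrmorphism A -> quotient_sort};
    quotient_map_surj : forall u, exists a, quotient_map a = u;
    quotient_map_ker : forall a, quotient_map a = 0 <-> I a
}.

Section EqQuotient.
Variables (K : fieldType) (A : algType K) (I : ideal A).

Definition ideal_equiv (a b : A) : bool := `[< I (a - b) >].

Let equivI_refl : reflexive ideal_equiv.
Proof. by move=> a; apply/asboolP; rewrite subrr; apply: ideal0. Qed.
Let equivI_sym : symmetric ideal_equiv.
Proof.
by move=> a b; apply/asboolP/asboolP => /idealN; rewrite opprB.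
Qed.
Let equivI_trans : transitive ideal_equiv.
Proof.
move=> b a c /asboolP Iab /asboolP Ibc; apply/asboolP.
by rewrite -(subrK b a) -addrA; apply: idealD.
Qed.
Canonical ideal_equiv_rel :=
  EquivRel ideal_equiv equivI_refl equivI_sym equivI_trans.

Definition eqquot : Type := {eq_quot ideal_equiv_rel}.
HB.instance Definition _ := Choice.on eqquot.

Definition ecls (a : A) : eqquot := \pi_{eq_quot ideal_equiv_rel} a.
Definition erep (u : eqquot) : A :=
  repr (u : {eq_quot ideal_equiv_rel}).

Lemma erepK u : ecls (erep u) = u. Proof. exact: reprK. Qed.

Lemma ecls_eqP a b : ecls a = ecls b <-> I (a - b).
Proof.
split=> [/eqmodP/asboolP //|Iab]; apply/eqmodP; exact/asboolP.
Qed.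

Lemma erep_ecls a : I (erep (ecls a) - a).
Proof. by apply/ecls_eqP; rewrite erepK. Qed.

Definition quot_add (u v : eqquot) := ecls (erep u + erep v).
Definition quot_opp (u : eqquot) := ecls (- erep u).
Definition quot_mul (u v : eqquot) := ecls (erep u * erep v).
Definition quot_scale (k : K) (u : eqquot) := ecls (k *: erep u).

Let addE a b : quot_add (ecls a) (ecls b) = ecls (a + b).
Proof. by apply/ecls_eqP; rewrite opprD addrACA; apply: idealD; apply: erep_ecls. Qed.
Let oppE a : quot_opp (ecls a) = ecls (- a).
Proof. by apply/ecls_eqP; rewrite -opprD; apply: idealN; apply: erep_ecls. Qed.
Let mulE a b : quot_mul (ecls a) (ecls b) = ecls (a * b).
Proof.
apply/ecls_eqP; set a' := erep _; set b' := erep _.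
have -> : a' * b' - a * b = (a' - a) * b' + a * (b' - b).
  by rewrite mulrBl mulrBr addrA subrK.
by apply: idealD; [apply: idealMr|apply: idealMl]; apply: erep_ecls.
Qed.
Let scaleE k a : quot_scale k (ecls a) = ecls (k *: a).
Proof. by apply/ecls_eqP; rewrite -scalerBr; apply: idealZ; apply: erep_ecls. Qed.

Let quotW (P : eqquot -> Prop) : (forall a, P (ecls a)) -> forall u, P u.
Proof. by move=> Pc u; rewrite -(erepK u). Qed.

Let qaddA : associative quot_add.
Proof.
by elim/quotW=> a; elim/quotW=> b; elim/quotW=> c; rewrite !addE addrA.
Qed.
Let qaddC : commutative quot_add.
Proof. by elim/quotW=> a; elim/quotW=> b; rewrite !addE addrC. Qed.
Let qadd0 : left_id (ecls 0) quot_add.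
Proof. by elim/quotW=> a; rewrite !addE add0r. Qed.
Let qaddN : left_inverse (ecls 0) quot_opp quot_add.
Proof. by elim/quotW=> a; rewrite oppE addE addNr. Qed.
HB.instance Definition _ :=
  GRing.isZmodule.Build eqquot qaddA qaddC qadd0 qaddN.

Let qmulA : associative quot_mul.
Proof.
by elim/quotW=> a; elim/quotW=> b; elim/quotW=> c; rewrite !mulE mulrA.
Qed.
Let qmul1l : left_id (ecls 1) quot_mul.
Proof. by elim/quotW=> a; rewrite mulE mul1r. Qed.
Let qmul1r : right_id (ecls 1) quot_mul.
Proof. by elim/quotW=> a; rewrite mulE mulr1. Qed.
Let qmulDl : left_distributive quot_mul +%R.
Proof.
elim/quotW=> a; elim/quotW=> b; elim/quotW=> c; rewrite /GRing.add /=.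
by rewrite !(addE, mulE) mulrDl.
Qed.
Let qmulDr : right_distributive quot_mul +%R.
Proof.
elim/quotW=> a; elim/quotW=> b; elim/quotW=> c; rewrite /GRing.add /=.
by rewrite !(addE, mulE) mulrDr.
Qed.
Let qone_neq0 : ecls 1 != 0.
Proof.
by apply/eqP => /ecls_eqP; rewrite subr0; apply: ideal_proper.
Qed.
HB.instance Definition _ := GRing.Zmodule_isNzRing.Build eqquot
  qmulA qmul1l qmul1r qmulDl qmulDr qone_neq0.

Let qscaleA k l u : quot_scale k (quot_scale l u) = quot_scale (k * l) u.
Proof. by elim/quotW: u => a; rewrite !scaleE scalerA. Qed.
Let qscale1 : left_id 1 quot_scale.
Proof. by elim/quotW=> a; rewrite scaleE scale1r. Qed.
Let qscaleDr : right_distributive quot_scale +%R.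
Proof.
move=> k; elim/quotW=> a; elim/quotW=> b; rewrite /GRing.add /=.
by rewrite !(addE, scaleE) scalerDr.
Qed.
Let qscaleDl u : {morph quot_scale^~ u : k l / k + l}.
Proof.
move=> k l; elim/quotW: u => a.
by rewrite /GRing.add /= !scaleE addE -scalerDl.
Qed.
HB.instance Definition _ := GRing.Zmodule_isLmodule.Build K eqquot
  qscaleA qscale1 qscaleDr qscaleDl.

Let qscaleAl k (u v : eqquot) : k *: (u * v) = (k *: u) * v.
Proof.
elim/quotW: u => a; elim/quotW: v => b.
by rewrite /GRing.scale /GRing.mul /= !(scaleE, mulE) scalerAl.
Qed.
HB.instance Definition _ := GRing.Lmodule_isLalgebra.Build K eqquot qscaleAl.
Let qscaleAr k (u v : eqquot) : k *: (u * v) = u * (k *: v).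
Proof.
elim/quotW: u => a; elim/quotW: v => b.
by rewrite /GRing.scale /GRing.mul /= !(scaleE, mulE) scalerAr.
Qed.
HB.instance Definition _ := GRing.Lalgebra_isAlgebra.Build K eqquot qscaleAr.

Let ecls_additive : zmod_morphism ecls.
Proof. by move=> a b; rewrite /GRing.add /GRing.opp /= oppE addE. Qed.
Let ecls_multiplicative : monoid_morphism ecls.
Proof. by split=> // a b; rewrite [RHS]mulE. Qed.
Let ecls_scalable : scalable ecls.
Proof. by move=> k a; rewrite [RHS]scaleE. Qed.
HB.instance Definition _ := GRing.isZmodMorphism.Build A eqquot ecls ecls_additive.
HB.instance Definition _ :=
  GRing.isMonoidMorphism.Build A eqquot ecls ecls_multiplicative.
HB.instance Definition _ := GRing.isScalable.Build K A eqquot *:%R ecls ecls_scalable.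

Lemma ecls0P a : ecls a = 0 <-> I a.
Proof. by rewrite -[0](rmorph0 ecls) ecls_eqP subr0. Qed.

Let ecls_surj u : exists a, ecls a = u.
Proof. by exists (erep u); apply: erepK. Qed.

Definition eqquot_algebra : quotient_algebra I :=
  @QuotientAlgebra K A I eqquot ecls ecls_surj ecls0P.

End EqQuotient.

Lemma quotient_algebra_exists (K : fieldType) (A : algType K) (I : ideal A) :
  quotient_algebra I.
Proof. exact: eqquot_algebra. Qed.

Section Quotient.
Variables (K : fieldType) (A : algType K) (I : ideal A).

Definition quot : algType K := quotient_sort (quotient_algebra_exists I).
Definition cls : {lrmorphism A -> quot} :=
  quotient_map (quotient_algebra_exists I).

Lemma cls_surj u : exists a, cls a = u.
Proof. exact: quotient_map_surj. Qed.
Lemma cls0P a : cls a = 0 <-> I a.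
Proof. exact: quotient_map_ker. Qed.

Definition rep (u : quot) : A := projT1 (cid (cls_surj u)).
Lemma repK u : cls (rep u) = u.
Proof. exact: projT2 (cid (cls_surj u)). Qed.
Lemma rep_cls a : I (rep (cls a) - a).
Proof. by apply/cls0P; rewrite linearB /= repK subrr. Qed.

Let quotW (P : quot -> Prop) : (forall a, P (cls a)) -> forall u, P u.
Proof. by move=> Pc u; rewrite -(repK u). Qed.

Section QuotLift.
Variables (B : algType K) (f : {lrmorphism A -> B}).
Hypothesis If : forall a, I a -> f a = 0.

Definition quot_lift_fun of (forall a, I a -> f a = 0) : quot -> B :=
  fun u => f (rep u).

Lemma quot_lift_funE a : quot_lift_fun If (cls a) = f a.
Proof. by apply/eqP; rewrite -subr_eq0 -rmorphB; apply/eqP/If/rep_cls. Qed.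

Let lift_additive : zmod_morphism (quot_lift_fun If).
Proof.
by elim/quotW=> a; elim/quotW=> b; rewrite -rmorphB !quot_lift_funE rmorphB.
Qed.
Let lift_multiplicative : monoid_morphism (quot_lift_fun If).
Proof.
split; first by rewrite -(rmorph1 cls) quot_lift_funE rmorph1.
by elim/quotW=> a; elim/quotW=> b; rewrite -rmorphM !quot_lift_funE rmorphM.
Qed.
Let lift_scalable : scalable (quot_lift_fun If).
Proof. by move=> k; elim/quotW=> a; rewrite -linearZ !quot_lift_funE linearZ. Qed.
HB.instance Definition _ :=
  GRing.isZmodMorphism.Build _ B (quot_lift_fun If) lift_additive.
HB.instance Definition _ :=
  GRing.isMonoidMorphism.Build quot B (quot_lift_fun If) lift_multiplicative.
HB.instance Definition _ :=
  GRing.isScalable.Build K quot B *:%R (quot_lift_fun If) lift_scalable.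

Definition quot_lift : {lrmorphism quot -> B} := quot_lift_fun If.
Lemma quot_liftE a : quot_lift (cls a) = f a.
Proof. exact: quot_lift_funE. Qed.

End QuotLift.

End Quotient.

Arguments quot_lift {K A I B} f If.
Arguments cls {K A} I.

Section Kernel.
Variables (K : fieldType) (A B : algType K) (f : {lrmorphism A -> B}).

Let ker0 : f 0 = 0. Proof. exact: rmorph0. Qed.
Let kerD a b : f a = 0 -> f b = 0 -> f (a + b) = 0.
Proof. by move=> fa fb; rewrite rmorphD /= fa fb addr0. Qed.
Let kerMl a b : f b = 0 -> f (a * b) = 0.
Proof. by move=> fb; rewrite rmorphM /= fb mulr0. Qed.
Let kerMr a b : f a = 0 -> f (a * b) = 0.
Proof. by move=> fa; rewrite rmorphM /= fa mul0r. Qed.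
Let ker1 : ~ f 1 = 0.
Proof. by move/eqP; rewrite rmorph1 oner_eq0. Qed.

Definition ker_ideal : ideal A :=
  @Ideal K A (fun a => f a = 0) ker0 kerD kerMl kerMr ker1.
End Kernel.

Section Cap.
Variables (K : fieldType) (A : algType K) (I J : ideal A).

Let cap (a : A) : Prop := I a /\ J a.
Let cap0 : cap 0. Proof. by split; apply: ideal0. Qed.
Let capD a b : cap a -> cap b -> cap (a + b).
Proof. by move=> [? ?] [? ?]; split; apply: idealD. Qed.
Let capMl a b : cap b -> cap (a * b).
Proof. by move=> [? ?]; split; apply: idealMl. Qed.
Let capMr a b : cap a -> cap (a * b).
Proof. by move=> [? ?]; split; apply: idealMr. Qed.
Let cap1 : ~ cap 1. Proof. by move=> [/ideal_proper]. Qed.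

Definition ideal_cap : ideal A :=
  @Ideal K A (fun a => I a /\ J a) cap0 capD capMl capMr cap1.
End Cap.

Lemma generated_sub (K : fieldType) (A : algType K) (I : ideal A)
    (S : A -> Prop) :
  (forall a, S a -> I a) -> forall a, generated S a -> I a.
Proof.
move=> SI a; elim=> {a} [a /SI //||a b _ Ia _ Ib|a b _ Ib|a b _ Ia].
- exact: ideal0.
- exact: idealD.
- exact: idealMl.
- exact: idealMr.
Qed.

Lemma generated_proper (K : fieldType) (A B : algType K)
    (f : {lrmorphism A -> B}) (S : A -> Prop) :
  (forall a, S a -> f a = 0) -> ~ generated S 1.
Proof. by move=> Sf /(@generated_sub _ _ (ker_ideal f) _ Sf); apply: ideal_proper. Qed.

(** [twisted s] is [B * B] with the product
    [(u, u') (v, v') = (u v, u' v + s u v')]: an algebra map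
    [w |-> (w, d w)] into it is the same thing as an [s]-twisted derivation,
    i.e., a linear [d] with [d (u v) = d u v + s u d v]. *)
Definition twisted (K : fieldType) (B : algType K) (s : {lrmorphism B -> B}) :
  Type := (B * B)%type.

Section Twisted.
Variables (K : fieldType) (B : algType K) (s : {lrmorphism B -> B}).
Local Notation T := (twisted s).

HB.instance Definition _ := GRing.Lmodule.on T.

Definition tw_one : T := (1, 0).
Definition tw_mul (u v : T) : T := (u.1 * v.1, u.2 * v.1 + s u.1 * v.2).

Let twE (u v : T) : u.1 = v.1 -> u.2 = v.2 -> u = v.
Proof. by case: u v => ? ? [? ?] /= -> ->. Qed.
Let tw_mulA : associative tw_mul.
Proof.
move=> u v w; apply: twE => /=; first by rewrite mulrA.
by rewrite rmorphM mulrDl mulrDr !mulrA addrA.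
Qed.
Let tw_mul1l : left_id tw_one tw_mul.
Proof.
by move=> u; apply: twE => /=; rewrite ?mul0r ?rmorph1 ?mul1r ?add0r.
Qed.
Let tw_mul1r : right_id tw_one tw_mul.
Proof. by move=> u; apply: twE => /=; rewrite ?mulr0 ?mulr1 ?addr0. Qed.
Let tw_mulDl : left_distributive tw_mul +%R.
Proof.
move=> u v w; apply: twE => /=; first by rewrite mulrDl.
by rewrite rmorphD !mulrDl addrACA.
Qed.
Let tw_mulDr : right_distributive tw_mul +%R.
Proof.
move=> u v w; apply: twE => /=; first by rewrite mulrDr.
by rewrite !mulrDr addrACA.
Qed.
Let tw_one_neq0 : tw_one != 0.
Proof. by apply/eqP => -[/eqP]; rewrite oner_eq0. Qed.
HB.instance Definition _ := GRing.Zmodule_isNzRing.Build T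
  tw_mulA tw_mul1l tw_mul1r tw_mulDl tw_mulDr tw_one_neq0.

Let tw_scaleAl (k : K) (u v : T) : k *: (u * v : T) = (k *: u : T) * v :> T.
Proof.
apply: twE => /=; first by rewrite scalerAl.
by rewrite linearZ /= scalerDr !scalerAl.
Qed.
HB.instance Definition _ := GRing.Lmodule_isLalgebra.Build K T tw_scaleAl.
Let tw_scaleAr (k : K) (u v : T) : k *: (u * v : T) = u * (k *: v : T) :> T.
Proof.
apply: twE => /=; first by rewrite scalerAr.
by rewrite scalerDr !scalerAr.
Qed.
HB.instance Definition _ := GRing.Lalgebra_isAlgebra.Build K T tw_scaleAr.

End Twisted.

Section Omega.
Variables (K : fieldType) (A : algType K).
Local Notation F := (free K (A + A)%type).
Local Notation i a := (gen K (inl a : (A + A)%type)).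
Local Notation δ a := (gen K (inr a : (A + A)%type)).

(** [Omega A] is presented by symbols [i a] and [δ a], for [a] in [A], subject
    to: [i] is a map of unital algebras, [δ] is linear and satisfies the
    Leibniz rule (hence [δ 1 = 0]). *)
Inductive omega_rel : F -> Prop :=
| omega_lin k a b : omega_rel (i (k *: a + b) - (k *: i a + i b))
| omega_one : omega_rel (i 1 - 1)
| omega_mul a b : omega_rel (i (a * b) - i a * i b)
| omega_dlin k a b : omega_rel (δ (k *: a + b) - (k *: δ a + δ b))
| omega_leibniz a b : omega_rel (δ (a * b) - (δ a * i b + i a * δ b)).

Section Rel.
Variables (B : algType K) (f g : A -> B).
Let h (s : A + A) : B := match s with inl a => f a | inr a => g a end.
Lemma omega_rel_ker :
    (forall k a b, f (k *: a + b) = k *: f a + f b) -> f 1 = 1 ->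
    (forall a b, f (a * b) = f a * f b) ->
    (forall k a b, g (k *: a + b) = k *: g a + g b) ->
    (forall a b, g (a * b) = g a * f b + f a * g b) ->
  forall w, omega_rel w -> free_lift h w = 0.
Proof.
move=> fL f1 fM gL gM w [k a b||a b|k a b|a b].
- by rewrite linearB linearP /= !free_liftE /= fL subrr.
- by rewrite rmorphB rmorph1 /= free_liftE /= f1 subrr.
- by rewrite rmorphB rmorphM /= !free_liftE /= fM subrr.
- by rewrite linearB linearP /= !free_liftE /= gL subrr.
- by rewrite rmorphB rmorphD !rmorphM /= !free_liftE /= gM subrr.
Qed.
End Rel.

Lemma omega_rel_proper : ~ generated omega_rel 1.
Proof.
apply: generated_proper (@omega_rel_ker A id (fun=> 0) _ _ _ _ _) => //.
- by move=> *; rewrite scaler0 addr0.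
- by move=> *; rewrite mul0r mulr0 addr0.
Qed.

Definition Omega : algType K := quot (ideal_gen omega_rel_proper).

Definition omega_in_fun (a : A) : Omega := cls _ (i a).
Definition omega_gend_fun (a : A) : Omega := cls _ (δ a).

Let cls_rel w : omega_rel w -> cls (ideal_gen omega_rel_proper) w = 0.
Proof. by move=> wR; apply/cls0P; apply: generated_base. Qed.

Let in_linear k a b :
  omega_in_fun (k *: a + b) = k *: omega_in_fun a + omega_in_fun b.
Proof.
apply/eqP; rewrite -subr_eq0 -linearP -linearB /=; apply/eqP/cls_rel.
exact: omega_lin.
Qed.
Let gend_linear k a b :
  omega_gend_fun (k *: a + b) = k *: omega_gend_fun a + omega_gend_fun b.
Proof.
apply/eqP; rewrite -subr_eq0 -linearP -linearB /=; apply/eqP/cls_rel.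
exact: omega_dlin.
Qed.
Let in_multiplicative : monoid_morphism omega_in_fun.
Proof.
split=> [|a b]; apply/eqP; rewrite -subr_eq0.
  rewrite -(rmorph1 (cls (ideal_gen omega_rel_proper))) -rmorphB.
  by apply/eqP/cls_rel/omega_one.
by rewrite -rmorphM -rmorphB; apply/eqP/cls_rel/omega_mul.
Qed.
HB.instance Definition _ :=
  GRing.isLinear.Build K A Omega *:%R omega_in_fun in_linear.
HB.instance Definition _ :=
  GRing.isMonoidMorphism.Build A Omega omega_in_fun in_multiplicative.
HB.instance Definition _ :=
  GRing.isLinear.Build K A Omega *:%R omega_gend_fun gend_linear.

Definition omega_in : {lrmorphism A -> Omega} := omega_in_fun.
(** The classes of the symbols [δ a]; see [omega_d_in]. *)
Definition omega_gend : {linear A -> Omega} := omega_gend_fun.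

Lemma omega_gendM a b :
  omega_gend (a * b) = omega_gend a * omega_in b + omega_in a * omega_gend b.
Proof.
have := cls_rel (omega_leibniz a b).
by rewrite rmorphB rmorphD !rmorphM /= => /eqP; rewrite subr_eq0 => /eqP.
Qed.

Lemma omega_ind (P : Omega -> Prop) :
    (forall u v, P u -> P v -> P (u + v)) ->
    (forall k u, P u -> P (k *: u)) -> P 1 ->
    (forall a u, P u -> P (omega_in a * u)) ->
    (forall a u, P u -> P (omega_gend a * u)) ->
  forall u, P u.
Proof.
move=> PD PZ P1 Pi Pd u; rewrite -(repK u); move: (rep u) => w {u}.
elim/free_generated: w => [v w Pv Pw|k w Pw||[a|a] w Pw].
- by rewrite rmorphD; apply: PD.
- by rewrite linearZ; apply: PZ.
- by rewrite rmorph1.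
- by rewrite rmorphM; apply: Pi.
- by rewrite rmorphM; apply: Pd.
Qed.

Section Lift.
Variables (B : algType K) (f : {lrmorphism A -> B}) (g : {linear A -> B}).
Hypothesis fgM : forall a b, g (a * b) = g a * f b + f a * g b.

Let h (s : A + A) : B := match s with inl a => f a | inr a => g a end.
Let h_ker w : ideal_gen omega_rel_proper w -> free_lift h w = 0.
Proof.
apply: (@generated_sub _ _ (ker_ideal (free_lift h))).
apply: omega_rel_ker => //.
- exact: linearP.
- exact: rmorph1.
- exact: rmorphM.
- exact: linearP.
Qed.

Definition omega_lift : {lrmorphism Omega -> B} := quot_lift (free_lift h) h_ker.

Lemma omega_lift_in a : omega_lift (omega_in a) = f a.
Proof. by rewrite [LHS]quot_liftE free_liftE. Qed.
Lemma omega_lift_gend a : omega_lift (omega_gend a) = g a.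
Proof. by rewrite [LHS]quot_liftE free_liftE. Qed.
End Lift.

Let gendNM a b : (\- omega_gend) (a * b) =
  (\- omega_gend) a * omega_in b + omega_in a * (\- omega_gend) b.
Proof. by rewrite /= omega_gendM opprD mulNr mulrN. Qed.

(** The grading automorphism, [(-1)^n] on forms of degree [n]. *)
Definition omega_sign : {lrmorphism Omega -> Omega} :=
  @omega_lift Omega omega_in (\- omega_gend) gendNM.
Lemma omega_sign_in a : omega_sign (omega_in a) = omega_in a.
Proof. exact: omega_lift_in. Qed.
Lemma omega_sign_gend a : omega_sign (omega_gend a) = - omega_gend a.
Proof. exact: omega_lift_gend. Qed.

Local Notation T := (twisted omega_sign).
Definition omega_jet_in (a : A) : T := (omega_in a, omega_gend a).
Definition omega_jet_gend (a : A) : T := (omega_gend a, 0).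
Let jet_in_linear : linear omega_jet_in.
Proof. by move=> k a b; rewrite /omega_jet_in !linearP. Qed.
Let jet_gend_linear : linear omega_jet_gend.
Proof.
move=> k a b; rewrite /omega_jet_gend linearP /=; congr (_, _).
by rewrite /= addr0; apply/esym/scaler0.
Qed.
Let jet_in_multiplicative : monoid_morphism omega_jet_in.
Proof.
split=> [|a b]; rewrite /omega_jet_in.
  rewrite rmorph1; congr (_, _); apply/eqP.
  have /eqP := omega_gendM 1 1.
  by rewrite !mulr1 rmorph1 mulr1 mul1r -subr_eq0 opprD addrA subrr sub0r oppr_eq0.
by rewrite omega_gendM rmorphM; congr (_, _); rewrite /= omega_sign_in.
Qed.
HB.instance Definition _ :=
  GRing.isLinear.Build K A T *:%R omega_jet_in jet_in_linear.
HB.instance Definition _ :=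
  GRing.isMonoidMorphism.Build A T omega_jet_in jet_in_multiplicative.
HB.instance Definition _ :=
  GRing.isLinear.Build K A T *:%R omega_jet_gend jet_gend_linear.
Let jetM a b : omega_jet_gend (a * b) =
  omega_jet_gend a * omega_jet_in b + omega_jet_in a * omega_jet_gend b.
Proof.
rewrite /omega_jet_gend omega_gendM; congr (_, _) => /=.
by rewrite omega_sign_gend mulNr mul0r mulr0 addr0 add0r addNr.
Qed.

Definition omega_jet : {lrmorphism Omega -> T} :=
  @omega_lift T omega_jet_in omega_jet_gend jetM.

Definition omega_d_fun (u : Omega) : Omega := (omega_jet u).2.
Let d_linear : linear omega_d_fun.
Proof. by move=> k u v; rewrite /omega_d_fun linearP. Qed.
HB.instance Definition _ :=
  GRing.isLinear.Build K Omega Omega *:%R omega_d_fun d_linear.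

(** The differential: the derivation, twisted by [omega_sign], with
    [d (i a) = δ a] and [d (δ a) = 0]. *)
Definition omega_d : {linear Omega -> Omega} := omega_d_fun.

Let jet1 u : (omega_jet u).1 = u.
Proof.
elim/omega_ind: u => [u v Pu Pv|k u Pu||a u Pu|a u Pu].
- by rewrite rmorphD /= Pu Pv.
- by rewrite linearZ /= Pu.
- by rewrite rmorph1.
- by rewrite rmorphM /= Pu omega_lift_in.
- by rewrite rmorphM /= Pu omega_lift_gend.
Qed.

Lemma omega_d_in a : omega_d (omega_in a) = omega_gend a.
Proof. by rewrite /omega_d /= /omega_d_fun omega_lift_in. Qed.

Lemma omega_d_gend a : omega_d (omega_gend a) = 0.
Proof. by rewrite /omega_d /= /omega_d_fun omega_lift_gend. Qed.

Lemma omega_dM u v : omega_d (u * v) = omega_d u * v + omega_sign u * omega_d v.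
Proof. by rewrite /omega_d /= /omega_d_fun rmorphM /= !jet1. Qed.

Lemma omega_d1 : omega_d 1 = 0.
Proof. by rewrite /omega_d /= /omega_d_fun rmorph1. Qed.

Lemma omega_d_inM a u :
  omega_d (omega_in a * u) = omega_gend a * u + omega_in a * omega_d u.
Proof. by rewrite omega_dM omega_d_in omega_sign_in. Qed.

Lemma omega_d_gendM a u :
  omega_d (omega_gend a * u) = - (omega_gend a * omega_d u).
Proof. by rewrite omega_dM omega_d_gend omega_sign_gend mul0r add0r mulNr. Qed.

Lemma omega_dd u : omega_d (omega_d u) = 0.
Proof.
elim/omega_ind: u => [u v Pu Pv|k u Pu||a u Pu|a u Pu].
- by rewrite !linearD /= Pu Pv addr0.
- by rewrite !linearZ /= Pu scaler0.
- by rewrite omega_d1 linear0.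
- by rewrite omega_d_inM linearD /= omega_d_gendM omega_d_inM Pu mulr0 addr0 addNr.
- by rewrite omega_d_gendM linearN /= omega_d_gendM Pu mulr0 !oppr0.
Qed.

(** [a0 d a1 ... d an]. *)
Definition omega_form (a0 : A) (s : seq A) : Omega :=
  omega_in a0 * \prod_(a <- s) omega_d (omega_in a).

(** The linear span of the forms [a0 d a1 ... d an]; scalars are absorbed in
    [a0]. *)
Definition omega_deg (n : nat) : set Omega :=
  [set w | exists s : seq (A * n.-tuple A),
    w = \sum_(x <- s) omega_form x.1 x.2].

Let augM a b : (\0 : A -> A) (a * b) = \0 a * b + a * \0 b.
Proof. by rewrite /= mul0r mulr0 addr0. Qed.
(** The projection onto degree [0], killing the forms of positive degree. *)
Definition omega_aug : {lrmorphism Omega -> A} :=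
  @omega_lift A idfun \0 augM.

Lemma omega_aug_in a : omega_aug (omega_in a) = a.
Proof. exact: omega_lift_in. Qed.
Lemma omega_aug_gend a : omega_aug (omega_gend a) = 0.
Proof. exact: omega_lift_gend. Qed.
Lemma omega_aug_d u : omega_aug (omega_d u) = 0.
Proof.
elim/omega_ind: u => [u v Pu Pv|k u Pu||a u Pu|a u Pu].
- by rewrite linearD rmorphD /= Pu Pv addr0.
- by rewrite !linearZ /= Pu scaler0.
- by rewrite omega_d1 rmorph0.
- by rewrite omega_d_inM rmorphD !rmorphM /= Pu omega_aug_gend mul0r mulr0 addr0.
- by rewrite omega_d_gendM rmorphN rmorphM /= omega_aug_gend mul0r oppr0.
Qed.

Lemma omega_aug_deg n u : omega_deg n u -> (0 < n)%N -> omega_aug u = 0.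
Proof.
case: n => // n [s ->] _; rewrite rmorph_sum big1 // => -[a0 [[|a t] //= ts]] _.
by rewrite /omega_form /= big_cons !rmorphM /= omega_aug_d mul0r mulr0.
Qed.

Lemma omega_deg0 u : omega_deg 0 u -> exists a, u = omega_in a.
Proof.
case=> s ->; exists (\sum_(x <- s) x.1); rewrite rmorph_sum; apply: eq_bigr.
by move=> [a t] _; rewrite /omega_form /= (tuple0 t) big_nil mulr1.
Qed.

End Omega.

Arguments omega_in {K A} : simpl never.
Arguments omega_gend {K A} : simpl never.
Arguments omega_lift {K A B f g} fgM : simpl never.
Arguments omega_sign {K A} : simpl never.
Arguments omega_d {K A} : simpl never.
Arguments omega_aug {K A} : simpl never.

Section Graded.
Variables (K : fieldType) (A : algType K).
Implicit Types (u v : Omega A).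

Lemma omega_sign_deg n u : omega_deg n u -> omega_sign u = (-1) ^+ n *: u.
Proof.
case=> s ->; rewrite rmorph_sum scaler_sumr; apply: eq_bigr => -[a0 t] _ /=.
rewrite /omega_form rmorphM /= omega_sign_in scalerAr; congr (_ * _).
rewrite -{2}(size_tuple t); elim: {t}(t : seq A) => [|a t IHt].
  by rewrite big_nil rmorph1 scale1r.
rewrite !big_cons rmorphM /= IHt omega_d_in omega_sign_gend exprS mulN1r.
by rewrite mulNr scaleNr scalerAr.
Qed.

Lemma omega_d_degM n u v : omega_deg n u ->
  omega_d (u * v) = omega_d u * v + (-1) ^+ n *: (u * omega_d v).
Proof. by move=> un; rewrite omega_dM (omega_sign_deg un) scalerAl. Qed.

End Graded.

Section OmegaMap.
Variables (K : fieldType) (A B : algType K) (f : {lrmorphism A -> B}).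

Let fM a b : (@omega_gend K B \o f) (a * b) =
  (@omega_gend K B \o f) a * (@omega_in K B \o f) b +
  (@omega_in K B \o f) a * (@omega_gend K B \o f) b.
Proof. by rewrite /= rmorphM omega_gendM. Qed.

(** [a0 d a1 ... d an |-> f a0 d (f a1) ... d (f an)] *)
Definition omega_map : {lrmorphism Omega A -> Omega B} :=
  @omega_lift K A (Omega B) (omega_in \o f) (omega_gend \o f) fM.
Arguments omega_map : simpl never.

Lemma omega_map_in a : omega_map (omega_in a) = omega_in (f a).
Proof. exact: omega_lift_in. Qed.
Lemma omega_map_gend a : omega_map (omega_gend a) = omega_gend (f a).
Proof. exact: omega_lift_gend. Qed.

Lemma omega_map_d u : omega_map (omega_d u) = omega_d (omega_map u).
Proof.
elim/omega_ind: u => [u v Pu Pv|k u Pu||a u Pu|a u Pu].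
- by rewrite linearD !rmorphD /= Pu Pv linearD.
- by rewrite !linearZ /= Pu.
- by rewrite omega_d1 rmorph0 rmorph1 omega_d1.
- rewrite omega_d_inM rmorphD !rmorphM /= Pu omega_map_in omega_map_gend.
  by rewrite omega_d_inM.
- rewrite omega_d_gendM rmorphN !rmorphM /= Pu omega_map_gend.
  by rewrite omega_d_gendM.
Qed.

Lemma omega_map_form a0 s :
  omega_map (omega_form a0 s) = omega_form (f a0) (map f s).
Proof.
rewrite /omega_form rmorphM rmorph_prod /= omega_map_in big_map.
by congr (_ * _); apply: eq_bigr => a _; rewrite omega_map_d omega_map_in.
Qed.

End OmegaMap.
Arguments omega_map {K A B} f : simpl never.

(** All differential calculi below are quotients of the universal one. *)
Record diff_ideal (K : fieldType) (A : algType K) := DiffIdeal {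
  diff_ideal_val :> ideal (Omega A);
  diff_ideal_d : forall w, diff_ideal_val w -> diff_ideal_val (omega_d w)
}.

Section Calculus.
Variables (K : fieldType) (A : algType K).

Section Quotient.
Variable J : diff_ideal A.

Definition calculus : algType K := quot J.

Definition calc_d_fun (u : calculus) : calculus := cls J (omega_d (rep u)).

Let calc_d_funE w : calc_d_fun (cls J w) = cls J (omega_d w).
Proof.
apply/eqP; rewrite -subr_eq0 -!linearB /=.
by apply/eqP/cls0P/diff_ideal_d/rep_cls.
Qed.
Let calc_d_linear : linear calc_d_fun.
Proof.
move=> k u v; rewrite -(repK u) -(repK v) -linearP.
by rewrite !calc_d_funE -linearP -linearP.
Qed.
HB.instance Definition _ :=
  GRing.isLinear.Build K calculus calculus *:%R calc_d_fun calc_d_linear.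
Definition calc_d : {linear calculus -> calculus} := calc_d_fun.
Lemma calc_dE w : calc_d (cls J w) = cls J (omega_d w).
Proof. exact: calc_d_funE. Qed.

Definition calc_in : {lrmorphism A -> calculus} := cls J \o @omega_in K A.

Definition calc_deg (n : nat) : set calculus :=
  [set cls J w | w in omega_deg n].

End Quotient.

(** The smallest two-sided ideal containing [S], stable under the differential
    and graded, i.e., containing the homogeneous components of its elements. *)
Inductive diff_generated (S : Omega A -> Prop) : Omega A -> Prop :=
| diff_generated_base w : S w -> diff_generated S w
| diff_generated0 : diff_generated S 0
| diff_generatedD u v :
    diff_generated S u -> diff_generated S v -> diff_generated S (u + v)
| diff_generatedMl u v : diff_generated S v -> diff_generated S (u * v)
| diff_generatedMr u v : diff_generated S u -> diff_generated S (u * v)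
| diff_generated_d w : diff_generated S w -> diff_generated S (omega_d w)
| diff_generated_deg N (w : nat -> Omega A) :
    (forall n, omega_deg n (w n)) -> diff_generated S (\sum_(n < N) w n) ->
    forall n, (n < N)%N -> diff_generated S (w n).

Section Generated.
Variable S : Omega A -> Prop.
(** No component in degree [0], so that the ideal is proper. *)
Hypothesis S_aug : forall w, S w -> omega_aug w = 0.

Lemma diff_generated_aug w : diff_generated S w -> omega_aug w = 0.
Proof.
elim=> {w} [w /S_aug //||u v _ u0 _ v0|u v _ v0|u v _ u0|w _ _|N w wd _ w0 n nN].
- exact: rmorph0.
- by rewrite rmorphD /= u0 v0 addr0.
- by rewrite rmorphM /= v0 mulr0.
- by rewrite rmorphM /= u0 mul0r.
- exact: omega_aug_d.
- have [n0|n0] := ltnP 0 n; first exact: omega_aug_deg (wd n) n0.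
  move: n0; rewrite leqn0 => /eqP n0; subst n; case: N nN w0 => // N _.
  rewrite big_ord_recl rmorphD /= rmorph_sum big1 ?addr0 // => i _.
  exact: omega_aug_deg (wd _) _.
Qed.

Let generated_proper : ~ diff_generated S 1.
Proof. by move/diff_generated_aug/eqP; rewrite rmorph1 oner_eq0. Qed.

Definition diff_ideal_gen : diff_ideal A :=
  @DiffIdeal K A (@Ideal K (Omega A) (diff_generated S) (diff_generated0 S)
    (@diff_generatedD S) (@diff_generatedMl S) (@diff_generatedMr S)
    generated_proper) (@diff_generated_d S).
End Generated.

End Calculus.

Arguments calc_in {K A} J.
Arguments calc_d {K A} J.
Arguments calc_deg {K A} J n.

Section Glue.
Variables (K : fieldType) (A B C : algType K).
Variables (f : {lrmorphism A -> B}) (g : {lrmorphism A -> C}).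
Variables (I : diff_ideal B) (J : diff_ideal C).

(** [a0 d a1 ... d an |-> f a0 d (f a1) ... d (f an)] with values in the
    calculus on [B], and similarly for [g]. *)
Definition glue_fst_omega : {lrmorphism Omega A -> calculus I} :=
  cls I \o omega_map f.
Definition glue_snd_omega : {lrmorphism Omega A -> calculus J} :=
  cls J \o omega_map g.
Arguments glue_fst_omega : simpl never.
Arguments glue_snd_omega : simpl never.

Definition glue_kernel : ideal (Omega A) :=
  ideal_cap (ker_ideal glue_fst_omega) (ker_ideal glue_snd_omega).

Let glue_kernel_d w : glue_kernel w -> glue_kernel (omega_d w).
Proof.
move=> [w1 w2]; split; rewrite /= /glue_fst_omega /glue_snd_omega /=
  omega_map_d -calc_dE; [move: w1|move: w2]; rewrite /= => ->; exact: linear0.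
Qed.

Definition glue_ideal : diff_ideal A := DiffIdeal glue_kernel_d.

Definition glue_fst : {lrmorphism calculus glue_ideal -> calculus I} :=
  @quot_lift K (Omega A) glue_ideal _ glue_fst_omega (fun w => @proj1 _ _).
Definition glue_snd : {lrmorphism calculus glue_ideal -> calculus J} :=
  @quot_lift K (Omega A) glue_ideal _ glue_snd_omega (fun w => @proj2 _ _).

Lemma glue_fstE w : glue_fst (cls glue_ideal w) = cls I (omega_map f w).
Proof. exact: quot_liftE. Qed.
Lemma glue_sndE w : glue_snd (cls glue_ideal w) = cls J (omega_map g w).
Proof. exact: quot_liftE. Qed.

End Glue.

Section FiberedProduct.
Variables (K : fieldType) (B C D : algType K).
Variables (f : {lrmorphism B -> D}) (g : {lrmorphism C -> D}).

Definition fibered_pred : {pred B * C} := fun u => f u.1 == g u.2.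

Fact fibered_closed : subalg_closed fibered_pred.
Proof.
split=> [|k u v /eqP uE /eqP vE|u v /eqP uE /eqP vE]; apply/eqP => /=.
- by rewrite !rmorph1.
- by rewrite !linearP /= uE vE.
- by rewrite !rmorphM /= uE vE.
Qed.
HB.instance Definition _ :=
  GRing.isSubalgClosed.Build K (B * C)%type fibered_pred fibered_closed.

Record fibered_product : predArgType := FiberedProduct {
  fibered_val :> B * C;
  fibered_valP : fibered_val \in fibered_pred
}.
HB.instance Definition _ := [isSub for fibered_val].
HB.instance Definition _ := [Choice of fibered_product by <:].
HB.instance Definition _ :=
  [SubChoice_isSubAlgebra of fibered_product by <:].

Definition fibered_fst_fun (u : fibered_product) : B := (fibered_val u).1.
Definition fibered_snd_fun (u : fibered_product) : C := (fibered_val u).2.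
Let fst_linear : linear fibered_fst_fun. Proof. by []. Qed.
Let snd_linear : linear fibered_snd_fun. Proof. by []. Qed.
Let fst_multiplicative : monoid_morphism fibered_fst_fun. Proof. by []. Qed.
Let snd_multiplicative : monoid_morphism fibered_snd_fun. Proof. by []. Qed.
HB.instance Definition _ :=
  GRing.isLinear.Build K fibered_product B *:%R fibered_fst_fun fst_linear.
HB.instance Definition _ :=
  GRing.isLinear.Build K fibered_product C *:%R fibered_snd_fun snd_linear.
HB.instance Definition _ := GRing.isMonoidMorphism.Build
  fibered_product B fibered_fst_fun fst_multiplicative.
HB.instance Definition _ := GRing.isMonoidMorphism.Build
  fibered_product C fibered_snd_fun snd_multiplicative.

Definition fibered_fst : {lrmorphism fibered_product -> B} := fibered_fst_fun.
Definition fibered_snd : {lrmorphism fibered_product -> C} := fibered_snd_fun.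

End FiberedProduct.

Definition Cx (R : realType) : numClosedFieldType := R[i]%C.

Definition circle (R : realType) : Type :=
  set_type [set z : Cx R | `|z| = 1].

Section Circle.
Variable R : realType.
Local Notation K := (Cx R).

HB.instance Definition _ := Topological.on (circle R).

Record circle_fun := CircleFun {
  circle_val :> circle R -> K;
  circle_continuous : continuous circle_val
}.
HB.instance Definition _ := gen_eqMixin circle_fun.
HB.instance Definition _ := gen_choiceMixin circle_fun.

Lemma circle_funP (f g : circle_fun) : (forall z, f z = g z) -> f = g.
Proof.
case: f g => [f fc] [g gc] /= /funext fg; subst g.
by congr CircleFun; apply: Prop_irrelevance.
Qed.

Lemma circle_one_proof : `|1 : K| = 1. Proof. exact: normr1. Qed.
Definition circle_one : circle R := exist _ 1 (mem_set circle_one_proof).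

Program Definition cf_cst (k : K) := @CircleFun (fun=> k) _.
Next Obligation. by move=> k; apply: cst_continuous. Qed.
Program Definition cf_add (f g : circle_fun) := @CircleFun (fun z => f z + g z) _.
Next Obligation.
by move=> f g z; apply: (@continuousD K K^o); apply: circle_continuous.
Qed.
Program Definition cf_opp (f : circle_fun) := @CircleFun (fun z => - f z) _.
Next Obligation.
by move=> f z; apply: (@continuousN K K^o); apply: circle_continuous.
Qed.
Program Definition cf_mul (f g : circle_fun) := @CircleFun (fun z => f z * g z) _.
Next Obligation.
by move=> f g z; apply: continuousM; apply: circle_continuous.
Qed.

Let cf_addA : associative cf_add.
Proof. by move=> f g h; apply: circle_funP => z /=; rewrite addrA. Qed.
Let cf_addC : commutative cf_add.
Proof. by move=> f g; apply: circle_funP => z /=; rewrite addrC. Qed.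
Let cf_add0 : left_id (cf_cst 0) cf_add.
Proof. by move=> f; apply: circle_funP => z /=; rewrite add0r. Qed.
Let cf_addN : left_inverse (cf_cst 0) cf_opp cf_add.
Proof. by move=> f; apply: circle_funP => z /=; rewrite addNr. Qed.
HB.instance Definition _ :=
  GRing.isZmodule.Build circle_fun cf_addA cf_addC cf_add0 cf_addN.

Let cf_mulA : associative cf_mul.
Proof. by move=> f g h; apply: circle_funP => z /=; rewrite mulrA. Qed.
Let cf_mul1l : left_id (cf_cst 1) cf_mul.
Proof. by move=> f; apply: circle_funP => z /=; rewrite mul1r. Qed.
Let cf_mul1r : right_id (cf_cst 1) cf_mul.
Proof. by move=> f; apply: circle_funP => z /=; rewrite mulr1. Qed.
Let cf_mulDl : left_distributive cf_mul cf_add.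
Proof. by move=> f g h; apply: circle_funP => z /=; rewrite mulrDl. Qed.
Let cf_mulDr : right_distributive cf_mul cf_add.
Proof. by move=> f g h; apply: circle_funP => z /=; rewrite mulrDr. Qed.
Let cf_one_neq0 : cf_cst 1 != 0.
Proof.
apply/eqP => /(congr1 (fun f : circle_fun => f circle_one))/eqP /=.
by rewrite oner_eq0.
Qed.
HB.instance Definition _ := GRing.Zmodule_isNzRing.Build circle_fun
  cf_mulA cf_mul1l cf_mul1r cf_mulDl cf_mulDr cf_one_neq0.

Definition cf_scale (k : K) (f : circle_fun) : circle_fun := cf_mul (cf_cst k) f.
Let cf_scaleA k l f : cf_scale k (cf_scale l f) = cf_scale (k * l) f.
Proof. by apply: circle_funP => z /=; rewrite mulrA. Qed.
Let cf_scale1 : left_id 1 cf_scale.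
Proof. by move=> f; apply: circle_funP => z /=; rewrite mul1r. Qed.
Let cf_scaleDr : right_distributive cf_scale cf_add.
Proof. by move=> k f g; apply: circle_funP => z /=; rewrite mulrDr. Qed.
Let cf_scaleDl f : {morph cf_scale^~ f : k l / k + l >-> cf_add k l}.
Proof. by move=> k l; apply: circle_funP => z /=; rewrite mulrDl. Qed.
HB.instance Definition _ := GRing.Zmodule_isLmodule.Build K circle_fun
  cf_scaleA cf_scale1 cf_scaleDr cf_scaleDl.

Let cf_scaleAl (k : K) (f g : circle_fun) : k *: (f * g) = (k *: f) * g.
Proof. by apply: circle_funP => z /=; rewrite mulrA. Qed.
HB.instance Definition _ :=
  GRing.Lmodule_isLalgebra.Build K circle_fun cf_scaleAl.
Let cf_scaleAr (k : K) (f g : circle_fun) : k *: (f * g) = f * (k *: g).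
Proof. by apply: circle_funP => z /=; rewrite mulrCA. Qed.
HB.instance Definition _ :=
  GRing.Lalgebra_isAlgebra.Build K circle_fun cf_scaleAr.

Definition circle_incl (z : circle R) : K := set_val z.

Let circle_incl_norm z : `|circle_incl z| = 1.
Proof. exact: set_mem (valP z). Qed.
Let circle_incl_neq0 z : circle_incl z != 0.
Proof. by rewrite -normr_gt0 circle_incl_norm ltr01. Qed.
Let circle_incl_continuous : continuous circle_incl.
Proof. exact: (@initial_continuous _ K (@set_val K _)). Qed.
Let circle_inv_continuous : continuous (fun z => (circle_incl z)^-1).
Proof.
move=> z.
exact: (cvgV (circle_incl_neq0 z) (@circle_incl_continuous z)).
Qed.

(** The canonical unitary generator [a] of [C(S^1)] and its adjoint
    [a^* = a^-1]; see [circle_gen_conj]. *)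
Definition circle_gen := CircleFun circle_incl_continuous.
Definition circle_gen_inv := CircleFun circle_inv_continuous.

Lemma circle_genV : circle_gen_inv * circle_gen = 1.
Proof.
by apply: circle_funP => z; apply: mulVf; apply: circle_incl_neq0.
Qed.
Lemma circle_genVr : circle_gen * circle_gen_inv = 1.
Proof.
by apply: circle_funP => z; apply: mulfV; apply: circle_incl_neq0.
Qed.
Lemma circle_gen_conj (z : circle R) : circle_gen_inv z = (circle_gen z)^*.
Proof.
by rewrite /= invC_norm circle_incl_norm expr1n invr1 mul1r.
Qed.

End Circle.

Section Disc.
Variables (R : realType) (q : R).
Local Notation K := (Cx R).

Definition realC (r : R) : K := (r%:C)%C.

Local Notation X := (gen K false).
Local Notation Xs := (gen K true).

(** The generators [x] and [x^*] are indexed by [false] and [true]. *)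
Definition disc_rel (w : free K bool) : Prop :=
  w = Xs * X - realC q *: (X * Xs) - realC (1 - q) *: 1.

Let phi0 (b : bool) : circle_fun R :=
  if b then circle_gen_inv R else circle_gen R.

Let phi0_rel w : disc_rel w -> free_lift phi0 w = 0.
Proof.
move=> ->; rewrite !linearB !linearZ /= !rmorphM rmorph1 /= !free_liftE /=.
have -> : realC (1 - q) = 1 - realC q by rewrite /realC rmorphB rmorph1.
by rewrite circle_genV circle_genVr scalerBl scale1r -opprD subrr.
Qed.

Lemma disc_rel_proper : ~ generated disc_rel 1.
Proof. exact: generated_proper phi0_rel. Qed.

Definition disc : algType K := quot (ideal_gen disc_rel_proper).
Definition disc_x : disc := cls _ X.
Definition disc_xs : disc := cls _ Xs.

Let phi_ker w : ideal_gen disc_rel_proper w -> free_lift phi0 w = 0.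
Proof. exact: (@generated_sub _ _ (ker_ideal (free_lift phi0)) _ phi0_rel). Qed.

Definition disc_phi : {lrmorphism disc -> circle_fun R} :=
  quot_lift (free_lift phi0) phi_ker.

Lemma disc_phi_x : disc_phi disc_x = circle_gen R.
Proof. by rewrite [LHS]quot_liftE free_liftE. Qed.
Lemma disc_phi_xs : disc_phi disc_xs = circle_gen_inv R.
Proof. by rewrite [LHS]quot_liftE free_liftE. Qed.

Let x := omega_in disc_x.
Let xs := omega_in disc_xs.
Let dx := omega_d x.
Let dxs := omega_d xs.

Inductive disc_diff_rel : Omega disc -> Prop :=
| disc_x_dx : disc_diff_rel (x * dx - realC q^-1 *: (dx * x))
| disc_xs_dxs : disc_diff_rel (xs * dxs - realC q *: (dxs * xs))
| disc_x_dxs : disc_diff_rel (x * dxs - realC q^-1 *: (dxs * x))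
| disc_xs_dx : disc_diff_rel (xs * dx - realC q *: (dx * xs)).

Lemma disc_diff_rel_aug w : disc_diff_rel w -> omega_aug w = 0.
Proof.
by case=> {w}; rewrite linearB linearZ /= !rmorphM /= omega_aug_d mulr0 mul0r
  scaler0 subrr.
Qed.

Definition disc_diff_ideal : diff_ideal disc := diff_ideal_gen disc_diff_rel_aug.

End Disc.

Section Sphere.
Variables (R : realType) (p q : R).

Definition sphere : algType (Cx R) :=
  fibered_product (disc_phi p) (disc_phi q).
Definition sphere_pi1 : {lrmorphism sphere -> disc p} :=
  fibered_fst (disc_phi p) (disc_phi q).
Definition sphere_pi2 : {lrmorphism sphere -> disc q} :=
  fibered_snd (disc_phi p) (disc_phi q).

Definition sphere_diff_ideal : diff_ideal sphere :=
  glue_ideal sphere_pi1 sphere_pi2 (disc_diff_ideal p) (disc_diff_ideal q).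
Definition sphere_piG1 :
    {lrmorphism calculus sphere_diff_ideal -> calculus (disc_diff_ideal p)} :=
  glue_fst sphere_pi1 sphere_pi2 (disc_diff_ideal p) (disc_diff_ideal q).
Definition sphere_piG2 :
    {lrmorphism calculus sphere_diff_ideal -> calculus (disc_diff_ideal q)} :=
  glue_snd sphere_pi1 sphere_pi2 (disc_diff_ideal p) (disc_diff_ideal q).

End Sphere.

(* Main.v *)
(** Surjectivity is the only real point.  For lifts [u], [v] in the sphere of
    generators [x], [x^*], the form [u dv] is a multiple of [dv u] in both
    calculi, but with different coefficients as [p != q]; hence the ideal that
    one calculus kills contains an element whose image in the other one is a
    nonzero multiple of [dv u].  Since [1] is a combination of [x x^*] and
    [x^* x], this yields [dv] itself, and then all forms of positive degree. *)
Require Import Defs.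
From HB Require Import structures.
From mathcomp Require Import all_boot all_order all_algebra.
From mathcomp Require Import complex.
From mathcomp Require Import boolp classical_sets functions reals.

Set Implicit Arguments.
Unset Strict Implicit.
Unset Printing Implicit Defensive.

Import Order.TTheory GRing.Theory Num.Theory.

Local Open Scope classical_set_scope.
Local Open Scope ring_scope.

(** * Homogeneous forms of the universal calculus *)

Section OmegaDegree.
Variables (K : fieldType) (A : algType K).

Lemma omega_deg_form n a (t : n.-tuple A) : omega_deg n (omega_form a t).
Proof. by exists [:: (a, t)]; rewrite big_seq1. Qed.

Lemma omega_deg_zero n : omega_deg n (0 : Omega A).
Proof. by exists [::]; rewrite big_nil. Qed.

Lemma omega_degD n (u v : Omega A) :
  omega_deg n u -> omega_deg n v -> omega_deg n (u + v).
Proof. by move=> [s ->] [t ->]; exists (s ++ t); rewrite big_cat. Qed.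

Lemma omega_deg_sum n (T : Type) (s : seq T) (F : T -> Omega A) :
  (forall x, omega_deg n (F x)) -> omega_deg n (\sum_(x <- s) F x).
Proof.
move=> Fn; elim: s => [|x s IHs]; first by rewrite big_nil; apply: omega_deg_zero.
by rewrite big_cons; apply: omega_degD.
Qed.

Lemma omega_deg_inM n a (u : Omega A) :
  omega_deg n u -> omega_deg n (omega_in a * u).
Proof.
move=> [s ->]; rewrite mulr_sumr; apply: omega_deg_sum => -[b t].
rewrite /omega_form mulrA -rmorphM; exact: omega_deg_form.
Qed.

Lemma omega_degZ n k (u : Omega A) : omega_deg n u -> omega_deg n (k *: u).
Proof.
(* The scalar is absorbed in the coefficient of degree [0], as the algebra element [k%:A]. *)
move=> /(omega_deg_inM k%:A).
by rewrite linearZ rmorph1 -scalerAl mul1r.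
Qed.

Lemma omega_form_rcons (b : A) t a :
  omega_form b (rcons t a) = omega_form b t * omega_gend a.
Proof. by rewrite /omega_form -cats1 big_cat big_seq1 omega_d_in mulrA. Qed.

Lemma omega_degM_gend n a (u : Omega A) :
  omega_deg n u -> omega_deg n.+1 (u * omega_gend a).
Proof.
move=> [s ->]; rewrite mulr_suml; apply: omega_deg_sum => -[b t] /=.
rewrite -omega_form_rcons; exact: (omega_deg_form b [tuple of rcons t a]).
Qed.

Lemma omega_deg1_gend (a : A) : omega_deg 1 (omega_gend a).
Proof.
rewrite -[X in omega_deg _ X]mul1r; apply: omega_degM_gend.
exists [:: (1, [tuple])].
by rewrite big_seq1 /omega_form /= big_nil mulr1 rmorph1.
Qed.

(** By the Leibniz rule, [dc a = d(c a) - c da], which brings the coefficients back to the left of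
    the differentials. *)
Lemma omega_deg1M_in a (u : Omega A) :
  omega_deg 1 u -> omega_deg 1 (u * omega_in a).
Proof.
move=> [s ->]; rewrite mulr_suml; apply: omega_deg_sum => -[b [[|c []] //= _]].
rewrite /omega_form big_seq1 omega_d_in -mulrA.
have -> : omega_gend c * omega_in a = omega_gend (c * a) - omega_in c * omega_gend a.
  by rewrite omega_gendM addrK.
apply/omega_deg_inM/omega_degD; first exact: omega_deg1_gend.
rewrite -scaleN1r; apply/omega_degZ/omega_deg_inM; exact: omega_deg1_gend.
Qed.

End OmegaDegree.

Lemma omega_map_deg (K : fieldType) (A B : algType K)
    (f : {lrmorphism A -> B}) n u :
  omega_deg n u -> omega_deg n (omega_map f u).
Proof.
move=> [s ->]; rewrite rmorph_sum; apply: omega_deg_sum => -[a t] /=.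
rewrite omega_map_form; exact: (omega_deg_form _ [tuple of map f t]).
Qed.

(** * Forms of one calculus that lift to forms vanishing in the other *)

Section LiftVanishing.
Variables (K : fieldType) (A B C : algType K).
Variables (f : {lrmorphism A -> B}) (g : {lrmorphism A -> C}).
Variables (I : diff_ideal B) (J : diff_ideal C).
Hypothesis f_surj : forall b, exists a, f a = b.

(** Equivalently, the pair [(eta, 0)] is the image of a form of degree [n] on [A]. The two calculi
    play asymmetric roles, so that exchanging [f] and [g] treats the pairs [(0, theta)]. *)
Definition lifts_vanishing n (eta : calculus I) :=
  exists2 w : Omega A, omega_deg n w &
    cls I (omega_map f w) = eta /\ cls J (omega_map g w) = 0.

Lemma lifts_vanishing0 n : lifts_vanishing n 0.
Proof. by exists 0; [apply: omega_deg_zero | rewrite !rmorph0]. Qed.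

Lemma lifts_vanishingD n eta theta :
  lifts_vanishing n eta -> lifts_vanishing n theta ->
  lifts_vanishing n (eta + theta).
Proof.
move=> [u un [<- u0]] [v vn [<- v0]]; exists (u + v); first exact: omega_degD.
by rewrite !rmorphD /= u0 v0 addr0.
Qed.

Lemma lifts_vanishingZ n k eta :
  lifts_vanishing n eta -> lifts_vanishing n (k *: eta).
Proof.
move=> [u un [<- u0]]; exists (k *: u); first exact: omega_degZ.
by rewrite !linearZ /= u0 scaler0.
Qed.

Lemma lifts_vanishing_inM n b eta :
  lifts_vanishing n eta -> lifts_vanishing n (cls I (omega_in b) * eta).
Proof.
have [a <-] := f_surj b; move=> [u un [<- u0]].
exists (omega_in a * u); first exact: omega_deg_inM.
by rewrite !rmorphM /= !omega_map_in u0 mulr0.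
Qed.

Lemma lifts_vanishing1M_in b eta :
  lifts_vanishing 1 eta -> lifts_vanishing 1 (eta * cls I (omega_in b)).
Proof.
have [a <-] := f_surj b; move=> [u un [<- u0]].
exists (u * omega_in a); first exact: omega_deg1M_in.
by rewrite !rmorphM /= !omega_map_in u0 mul0r.
Qed.

Lemma lifts_vanishingM_gend n b eta :
  lifts_vanishing n eta -> lifts_vanishing n.+1 (eta * cls I (omega_gend b)).
Proof.
have [a <-] := f_surj b; move=> [u un [<- u0]].
exists (u * omega_gend a); first exact: omega_degM_gend.
by rewrite !rmorphM /= !omega_map_gend u0 mul0r.
Qed.

(** In a product, a single factor whose lift vanishes in the second calculus makes the whole lift
    vanish there. The other factors can be lifted arbitrarily, as [f] is surjective. *)
Lemma lifts_vanishing_all :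
    (forall b, lifts_vanishing 1 (cls I (omega_gend b))) ->
  forall n eta, (0 < n)%N -> calc_deg I n eta -> lifts_vanishing n eta.
Proof.
move=> lift1 [//|n] _ _ [w [s ->] <-].
have lift_form m b t : size t = m.+1 ->
    lifts_vanishing m.+1 (cls I (omega_form b t)).
  elim/last_ind: t m => [//|t a IHt] m; rewrite size_rcons => -[tm].
  (* Longer products inherit the property from their prefix; the base case is a single differential
     with a coefficient on its left. *)
  case: m tm => [/size0nil ->|m tm]; last first.
    by rewrite omega_form_rcons rmorphM; apply/lifts_vanishingM_gend/IHt.
  rewrite /omega_form /= big_seq1 omega_d_in rmorphM.
  exact: (lifts_vanishing_inM b (lift1 a)).
rewrite rmorph_sum; elim: s => [|[b t] s IHs].
  by rewrite big_nil; apply: lifts_vanishing0.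
rewrite big_cons; apply: lifts_vanishingD => //=.
by apply: lift_form; rewrite size_tuple.
Qed.

(** The form [u dv - c' dv u] vanishes in the second calculus and becomes [(c - c') dv u] in the
    first, where [c - c'] is invertible. *)
Lemma lifts_vanishing_commutation (c c' : K) u v : c != c' ->
    cls I (omega_in (f u) * omega_gend (f v)) =
      c *: cls I (omega_gend (f v) * omega_in (f u)) ->
    cls J (omega_in (g u) * omega_gend (g v)) =
      c' *: cls J (omega_gend (g v) * omega_in (g u)) ->
  lifts_vanishing 1 (cls I (omega_gend (f v) * omega_in (f u))).
Proof.
move=> cc' fuv guv.
rewrite -[X in lifts_vanishing _ X]scale1r -(@mulVf _ (c - c')) ?subr_eq0 //.
rewrite -scalerA; apply: lifts_vanishingZ.
exists (omega_in u * omega_gend v - c' *: (omega_gend v * omega_in u)).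
  apply: omega_degD; first by apply/omega_deg_inM/omega_deg1_gend.
  rewrite -scaleNr; apply/omega_degZ/omega_deg1M_in; exact: omega_deg1_gend.
rewrite !linearB !linearZ /= !(rmorphM (omega_map _)) /=.
by rewrite !omega_map_in !omega_map_gend fuv guv scalerBl !scalerN subrr.
Qed.

End LiftVanishing.

(** * Generators and relations of the quantum disc *)

Section Disc.
Variables (R : realType) (q : R).

Lemma disc_ind (P : disc q -> Prop) :
    (forall a b, P a -> P b -> P (a + b)) ->
    (forall k a, P a -> P (k *: a)) -> P 1 ->
    (forall a, P a -> P (disc_x q * a)) ->
    (forall a, P a -> P (disc_xs q * a)) ->
  forall a, P a.
Proof.
move=> PD PZ P1 Px Pxs a; rewrite -(repK a); move: (rep a) => w {a}.
elim/free_generated: w => [v w Pv Pw|k w Pw||[] w Pw].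
- by rewrite rmorphD; apply: PD.
- by rewrite linearZ; apply: PZ.
- by rewrite rmorph1.
- by rewrite rmorphM; apply: Pxs.
- by rewrite rmorphM; apply: Px.
Qed.

Lemma disc_xsx :
  disc_xs q * disc_x q - realC q *: (disc_x q * disc_xs q) = realC (1 - q) *: 1.
Proof.
apply/eqP; rewrite -subr_eq0; apply/eqP.
have /cls0P : ideal_gen (@disc_rel_proper R q) _ := generated_base erefl.
by rewrite !linearB !linearZ /= !rmorphM rmorph1.
Qed.

Lemma disc_surj (A : algType (Cx R)) (f : {lrmorphism A -> disc q}) X Xs :
  f X = disc_x q -> f Xs = disc_xs q -> forall b, exists a, f a = b.
Proof.
move=> fX fXs; elim/disc_ind => [_ _ [a <-] [b <-]|k _ [a <-]||_ [a <-]|_ [a <-]].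
- by exists (a + b); rewrite rmorphD.
- by exists (k *: a); rewrite linearZ.
- by exists 1; rewrite rmorph1.
- by exists (X * a); rewrite rmorphM /= fX.
- by exists (Xs * a); rewrite rmorphM /= fXs.
Qed.

Lemma disc_diff_relE u v k :
    disc_diff_rel (omega_in u * omega_d (omega_in v)
      - k *: (omega_d (omega_in v) * omega_in u)) ->
  cls (disc_diff_ideal q) (omega_in u * omega_gend v) =
    k *: cls (disc_diff_ideal q) (omega_gend v * omega_in u).
Proof.
move=> uvk; apply/eqP; rewrite -subr_eq0 -linearZ -linearB -omega_d_in.
exact/eqP/cls0P/diff_generated_base.
Qed.

End Disc.

(** * Lifting the forms of one disc to forms that vanish on the other *)

Section GluedDiscs.
Variables (R : realType) (p q : R) (A : algType (Cx R)).
Variables (f : {lrmorphism A -> disc p}) (g : {lrmorphism A -> disc q}).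
Variables X Xs : A.
Hypotheses (fX : f X = disc_x p) (fXs : f Xs = disc_xs p).
Hypotheses (gX : g X = disc_x q) (gXs : g Xs = disc_xs q).
Hypotheses (p1 : p < 1) (pq : p != q).

Local Notation I := (disc_diff_ideal p).
Local Notation lift := (lifts_vanishing f g (disc_diff_ideal q)).

Let f_surj := disc_surj fX fXs.

(** The disc relation, multiplied on the left by [dv], reads [(1 - p) dv = dv x^* x - p dv x x^*],
    and [1 - p] is invertible as [p < 1]. Both terms on the right are right multiples of the two
    forms assumed to lift. *)
Lemma disc_lifts_gend v :
    lift 1 (cls I (omega_gend v * omega_in (disc_x p))) ->
    lift 1 (cls I (omega_gend v * omega_in (disc_xs p))) ->
  lift 1 (cls I (omega_gend v)).
Proof.
move=> vx vxs.
have p1' : realC (1 - p) != 0.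
  by rewrite /realC (fmorph_eq0 (@real_complex R)) subr_eq0 gt_eqF.
rewrite -[X in lifts_vanishing _ _ _ _ X]scale1r -(mulVf p1') -scalerA.
apply: lifts_vanishingZ; rewrite -linearZ.
have -> : realC (1 - p) *: omega_gend v =
    omega_gend v * omega_in (disc_xs p) * omega_in (disc_x p)
    - realC p *: (omega_gend v * omega_in (disc_x p) * omega_in (disc_xs p)).
  rewrite -!mulrA scalerAr -mulrBr.
  have -> : omega_in (disc_xs p) * omega_in (disc_x p)
      - realC p *: (omega_in (disc_x p) * omega_in (disc_xs p)) =
      realC (1 - p) *: 1 :> Omega (disc p).
    rewrite -(rmorph1 omega_in) -linearZ -disc_xsx linearB rmorphM /=.
    by congr (_ - _); rewrite linearZ /= rmorphM.
  by rewrite -scalerAr mulr1.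
rewrite linearB /= linearZ /= -scaleNr !rmorphM /=.
rewrite rmorphM in vx; rewrite rmorphM in vxs.
by apply: lifts_vanishingD; [|apply: lifts_vanishingZ];
  apply: lifts_vanishing1M_in.
Qed.

(** In all four commutation rules the coefficient depends only on the factor being moved across the
    differential: it is [p^-1] against [q^-1] for [x], and [p] against [q] for [x^*]. Since
    [p != q], these always differ, and each of the four products [dv u] of generators lifts. *)
Lemma disc_lifts_generators :
  lift 1 (cls I (omega_gend (disc_x p))) /\
  lift 1 (cls I (omega_gend (disc_xs p))).
Proof.
have realC_inj (r s : R) : r != s -> realC r != realC s.
  by apply: contra => /eqP/(@fmorph_inj _ _ (@real_complex R))->.
have pqV : realC p^-1 != realC q^-1.
  by apply: realC_inj; rewrite (inj_eq invr_inj).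
have pq' := realC_inj _ _ pq.
have lift_dM u v c c' : c != c' ->
    disc_diff_rel (omega_in (f u) * omega_d (omega_in (f v))
      - c *: (omega_d (omega_in (f v)) * omega_in (f u))) ->
    disc_diff_rel (omega_in (g u) * omega_d (omega_in (g v))
      - c' *: (omega_d (omega_in (g v)) * omega_in (g u))) ->
    lift 1 (cls I (omega_gend (f v) * omega_in (f u))).
  move=> cc' fuv guv.
  by apply: (lifts_vanishing_commutation cc'); apply: disc_diff_relE.
split; apply: disc_lifts_gend.
- rewrite -fX; apply: (lift_dM _ _ _ _ pqV); rewrite ?fX ?gX; constructor.
- rewrite -fX -fXs; apply: (lift_dM _ _ _ _ pq');
    rewrite ?fX ?gX ?fXs ?gXs; constructor.
- rewrite -fX -fXs; apply: (lift_dM _ _ _ _ pqV);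
    rewrite ?fX ?gX ?fXs ?gXs; constructor.
- rewrite -fXs; apply: (lift_dM _ _ _ _ pq'); rewrite ?fXs ?gXs; constructor.
Qed.

(** It is enough to lift every [db]. The elements [b] for which this is possible form a subalgebra,
    by the Leibniz rule, and it contains both generators. *)
Lemma disc_lifts n eta : (0 < n)%N -> calc_deg I n eta -> lift n eta.
Proof.
have [dx dxs] := disc_lifts_generators.
move: n eta; apply: (lifts_vanishing_all f_surj).
have lift_gendM u a : lift 1 (cls I (omega_gend u)) ->
    lift 1 (cls I (omega_gend a)) -> lift 1 (cls I (omega_gend (u * a))).
  move=> du da; rewrite omega_gendM rmorphD !rmorphM.
  by apply: lifts_vanishingD;
    [apply: lifts_vanishing1M_in | apply: lifts_vanishing_inM].
elim/disc_ind => [a b da db|k a da||a|a].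
- by rewrite !linearD; apply: lifts_vanishingD.
- by rewrite !linearZ; apply: lifts_vanishingZ.
- rewrite -omega_d_in rmorph1 omega_d1 rmorph0; exact: lifts_vanishing0.
- exact: lift_gendM.
- exact: lift_gendM.
Qed.

End GluedDiscs.

Theorem mainTheorem16 (R : realType) (p q : R) :
  0 < p < 1 -> 0 < q < 1 -> p != q ->
  set_bij [set: sphere p q] (calc_deg (sphere_diff_ideal p q) 0)
    (calc_in (sphere_diff_ideal p q))
  /\
  (forall n : nat, (0 < n)%N ->
     set_bij (calc_deg (sphere_diff_ideal p q) n)
       (calc_deg (disc_diff_ideal p) n `*` calc_deg (disc_diff_ideal q) n)
       (fun w => (sphere_piG1 p q w, sphere_piG2 p q w))).
Proof.
move=> /andP[_ p1] /andP[_ q1] pq; split; first split.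
- move=> a _; exists (omega_in a) => //.
  exists [:: (a, [tuple])].
  by rewrite big_seq1 /omega_form /= big_nil mulr1.
(* Both images of [a - b] lie in the differential ideals of the discs, whose elements have no
   component of degree [0]. Hence both components of [a - b] in the fibered product are zero. *)
- move=> a b _ _ /eqP; rewrite -subr_eq0 -rmorphB => /eqP/cls0P[].
  rewrite /= /glue_fst_omega /glue_snd_omega /= !omega_map_in.
  move=> /cls0P/diff_generated_aug-/(_ (@disc_diff_rel_aug R p)).
  rewrite omega_aug_in => ab1.
  move=> /cls0P/diff_generated_aug-/(_ (@disc_diff_rel_aug R q)).
  rewrite omega_aug_in => ab2.
  apply/eqP; rewrite -subr_eq0; apply/eqP/val_inj.
  by rewrite [LHS]surjective_pairing; congr (_, _).
- by move=> _ [w /omega_deg0[a ->] <-]; exists a.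
have piG1E w : sphere_piG1 p q (cls _ w) =
    cls (disc_diff_ideal p) (omega_map (sphere_pi1 p q) w) by exact: glue_fstE.
have piG2E w : sphere_piG2 p q (cls _ w) =
    cls (disc_diff_ideal q) (omega_map (sphere_pi2 p q) w) by exact: glue_sndE.
move=> n n_gt0; split.
- move=> _ [w wn <-]; split; [exists (omega_map (sphere_pi1 p q) w) |
    exists (omega_map (sphere_pi2 p q) w)]; try exact: omega_map_deg.
    exact/esym/piG1E.
  exact/esym/piG2E.
(* Injectivity is built into the gluing: the ideal divided out is the intersection of the two
   kernels. *)
- move=> u v _ _; rewrite -(repK u) -(repK v) => /eqP.
  rewrite xpair_eqE !piG1E !piG2E -subr_eq0 -[X in _ && X]subr_eq0 -!rmorphB.
  move=> /andP[/eqP uv1 /eqP uv2].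
  by apply/eqP; rewrite -subr_eq0 -rmorphB; apply/eqP/cls0P.
- move=> [eta theta] [eta_n theta_n].
  (* The generators of the two discs have the same image on the circle, so their pairs are elements
     of the sphere lifting both at once. *)
  have xP : (disc_x p, disc_x q) \in fibered_pred (disc_phi p) (disc_phi q).
    by apply/eqP; rewrite /= !disc_phi_x.
  have xsP : (disc_xs p, disc_xs q) \in fibered_pred (disc_phi p) (disc_phi q).
    by apply/eqP; rewrite /= !disc_phi_xs.
  pose X : sphere p q := FiberedProduct xP.
  pose Xs : sphere p q := FiberedProduct xsP.
  (* [u] is sent to [(eta, 0)] and, with the discs exchanged, [v] is sent to [(0, theta)]; their sum
     is the required preimage. *)
  have [u un [u1 u2]] := @disc_lifts R p q _ (sphere_pi1 p q) (sphere_pi2 p q)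
    X Xs erefl erefl erefl erefl p1 pq n eta n_gt0 eta_n.
  have qp : q != p by rewrite eq_sym.
  have [v vn [v2 v1]] := @disc_lifts R q p _ (sphere_pi2 p q) (sphere_pi1 p q)
    X Xs erefl erefl erefl erefl q1 qp n theta n_gt0 theta_n.
  exists (cls (sphere_diff_ideal p q) (u + v)).
    by exists (u + v); first exact: omega_degD.
  apply/eqP; rewrite xpair_eqE piG1E piG2E !rmorphD /=.
  by move: u1 u2 v1 v2 => /= -> -> -> ->; rewrite addr0 add0r !eqxx.
Qed.
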